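(* Let $A$ be a $k$-algebra, let $h>1$ be a divisor of $n$ and let $g_l\colon A\to A$ ($0\le l<n/h$) be $k$-linear maps satisfying $g_l(1)=0$. Assume that $g_0^h=0$ (where $g_0^j$ denotes the $j$-fold composition of $g_0$ with itself) and that there exists $x\in A$ such that $q:=g_0^{h-1}(x)$ is invertible. Suppose furthermore that $B:=\ker g_0$ is a $k$-subalgebra of the center of $A$ and that all the $g_l$'s are $B$-linear maps. Then there exists a unique twisting map $s\colon C\otimes A\to A\otimes C$ such that $\gamma^1_{lh}=g_l$ for all $0\le l<n/h$. Moreover, $s(c\otimes b)=b\otimes c$ for all $c\in C$ and $b\in B$.
   Context: $k$ is a commutative ring; all algebras are associative unital $k$-algebras, all maps are $k$-linear and $\otimes$ means $\otimes_k$. $n\ge 1$ is an integer and $C:=k[y]/\langle y^n\rangle$. A twisting map is a $k$-linear map $s\colon C\otimes A\to A\otimes C$ such that (1) $s(1\otimes a)=a\otimes 1$ and $s(c\otimes 1)=1\otimes c$ for all $a\in A$, $c\in C$; (2) $s\circ(\mu_C\otimes A)=(A\otimes\mu_C)\circ(s\otimes C)\circ(C\otimes s)$; (3) $s\circ(C\otimes\mu_A)=(\mu_A\otimes C)\circ(A\otimes s)\circ(s\otimes A)$, where $\mu_A,\mu_C$ are the multiplication maps and an algebra symbol also denotes its identity map. A $k$-linear map $s\colon C\otimes A\to A\otimes C$ determines $k$-linear maps $\gamma^r_j\colon A\to A$ ($0\le j,r<n$) by $s(y^r\otimes a)=\sum_{j=0}^{n-1}\gamma^r_j(a)\otimes y^j$.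 *)

(* Defs.v *)
From HB Require Import structures.
From mathcomp Require Import all_boot all_order all_algebra.
From mathcomp Require Import boolp.

Set Implicit Arguments.
Unset Strict Implicit.
Unset Printing Implicit Defensive.

Import GRing.Theory.
Local Open Scope ring_scope.
Local Open Scope quotient_scope.

Reserved Notation "M \ox N" (at level 40, left associativity).
Reserved Notation "m \ot n" (at level 40, left associativity).

(* The tensor product of two k-modules: formal sums of pairs (m, n),          *)
(* represented by lists, modulo the congruence generated by bilinearity.      *)
(* Opposites need not be added formally, as - (m, n) is (- m, n).             *)

Section TensorRelation.
Variables (k : comNzRingType) (M N : lmodType k).

Inductive tensor_rel : seq (M * N) -> seq (M * N) -> Prop :=
| TRrefl u : tensor_rel u u
| TRsym u v : tensor_rel u v -> tensor_rel v u
| TRtrans v u w : tensor_rel u v -> tensor_rel v w -> tensor_rel u w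
| TRcat u u' v v' :
    tensor_rel u u' -> tensor_rel v v' -> tensor_rel (u ++ v) (u' ++ v')
| TRcomm u v : tensor_rel (u ++ v) (v ++ u)
| TR0 n : tensor_rel [:: (0, n)] [::]
| TRaddl m m' n : tensor_rel [:: (m + m', n)] [:: (m, n); (m', n)]
| TRaddr m n n' : tensor_rel [:: (m, n + n')] [:: (m, n); (m, n')]
| TRscale a m n : tensor_rel [:: (a *: m, n)] [:: (m, a *: n)].

Definition tensor_eqv : rel (seq (M * N)) := fun u v => `[< tensor_rel u v >].

Lemma tensor_eqv_refl : reflexive tensor_eqv.
Proof. by move=> u; apply/asboolP; apply: TRrefl. Qed.
Lemma tensor_eqv_sym : symmetric tensor_eqv.
Proof. by move=> u v; apply/asboolP/asboolP; apply: TRsym. Qed.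
Lemma tensor_eqv_trans : transitive tensor_eqv.
Proof.
move=> v u w /asboolP uv /asboolP vw; apply/asboolP.
exact: TRtrans uv vw.
Qed.

Canonical tensor_equiv :=
  EquivRel tensor_eqv tensor_eqv_refl tensor_eqv_sym tensor_eqv_trans.

Definition tensor := {eq_quot tensor_equiv}.

HB.instance Definition _ := Choice.on tensor.
HB.instance Definition _ := EqQuotient.on tensor.

Lemma tensor_eqP (u v : seq (M * N)) :
  tensor_rel u v <-> \pi_tensor u = \pi_tensor v.
Proof.
by split=> [uv|/eqquotP/asboolP//]; apply/eqquotP/asboolP.
Qed.

Lemma tensor_reprP (u : seq (M * N)) : tensor_rel (repr (\pi_tensor u)) u.
Proof. by apply/tensor_eqP; rewrite reprK. Qed.

Lemma tensorW (P : tensor -> Prop) :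
  (forall u, P (\pi_tensor u)) -> forall t, P t.
Proof. by move=> Ppi t; rewrite -[t]reprK. Qed.

Definition tensor_scale_seq (a : k) (u : seq (M * N)) :=
  [seq (a *: x.1, x.2) | x <- u].

Lemma tensor_rel_scale a u v :
  tensor_rel u v -> tensor_rel (tensor_scale_seq a u) (tensor_scale_seq a v).
Proof.
elim=> /=.
- by move=> w; apply: TRrefl.
- by move=> u0 v0 _ /TRsym.
- by move=> u0 v0 w0 _ uv _ vw; apply: TRtrans uv vw.
- move=> ? ? ? ? _ ? _ ?; rewrite /tensor_scale_seq !map_cat; exact: TRcat.
- move=> ? ?; rewrite /tensor_scale_seq !map_cat; exact: TRcomm.
- by move=> n; rewrite scaler0; apply: TR0.
- by move=> m m' n; rewrite scalerDr; apply: TRaddl.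
- by move=> m n n'; apply: TRaddr.
- by move=> b m n; rewrite scalerA mulrC -scalerA; apply: TRscale.
Qed.

Definition tensor_zero : tensor := \pi_tensor [::].
Definition tensor_add (s t : tensor) : tensor := \pi_tensor (repr s ++ repr t).
Definition tensor_scale (a : k) (t : tensor) : tensor :=
  \pi_tensor (tensor_scale_seq a (repr t)).
Definition tensor_opp (t : tensor) : tensor := tensor_scale (- 1) t.

Lemma tensor_addE u v : tensor_add (\pi_tensor u) (\pi_tensor v) = \pi_tensor (u ++ v).
Proof. by apply/tensor_eqP/TRcat; apply: tensor_reprP. Qed.
Lemma tensor_scaleE a u :
  tensor_scale a (\pi_tensor u) = \pi_tensor (tensor_scale_seq a u).
Proof. exact/tensor_eqP/tensor_rel_scale/tensor_reprP. Qed.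

Lemma tensor_addA : associative tensor_add.
Proof.
move=> x y z; elim/tensorW: x => u; elim/tensorW: y => v; elim/tensorW: z => w.
by rewrite !tensor_addE catA.
Qed.
Lemma tensor_addC : commutative tensor_add.
Proof.
move=> x y; elim/tensorW: x => u; elim/tensorW: y => v; rewrite !tensor_addE.
exact/tensor_eqP/TRcomm.
Qed.
Lemma tensor_add0 : left_id tensor_zero tensor_add.
Proof. by move=> t; elim/tensorW: t => u; rewrite tensor_addE. Qed.

Lemma tensor_scaleDl_seq a b u :
  tensor_rel (tensor_scale_seq (a + b) u)
             (tensor_scale_seq a u ++ tensor_scale_seq b u).
Proof.
elim: u => [|[m n] u IH] /=; first exact: TRrefl.
apply: (TRtrans (v := [:: (a *: m, n); (b *: m, n)] ++
                      (tensor_scale_seq a u ++ tensor_scale_seq b u))).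
  rewrite -cat1s; apply: TRcat IH; rewrite scalerDl; exact: TRaddl.
rewrite /= -cat1s -[X in tensor_rel _ X]cat1s; apply: TRcat; first exact: TRrefl.
rewrite -cat1s -[(_, _) :: tensor_scale_seq b u]cat1s !catA.
by apply: TRcat; [apply: TRcomm | apply: TRrefl].
Qed.

Lemma tensor_scale0_seq u : tensor_rel (tensor_scale_seq 0 u) [::].
Proof.
elim: u => [|[m n] u IH] /=; first exact: TRrefl.
rewrite -cat1s -[X in tensor_rel _ X]cat0s; apply: TRcat IH.
by rewrite scale0r; apply: TR0.
Qed.

Lemma tensor_scale1 : left_id 1 tensor_scale.
Proof.
move=> t; elim/tensorW: t => u; rewrite tensor_scaleE /tensor_scale_seq.
by congr (\pi_tensor _); rewrite -[RHS]map_id; apply: eq_map => -[m n]; rewrite scale1r.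
Qed.
Lemma tensor_scaleDl t : {morph tensor_scale^~ t : a b / a + b >-> tensor_add a b}.
Proof.
move=> a b; elim/tensorW: t => u; rewrite !tensor_scaleE tensor_addE.
exact/tensor_eqP/tensor_scaleDl_seq.
Qed.
Lemma tensor_addN : left_inverse tensor_zero tensor_opp tensor_add.
Proof.
move=> t; rewrite /tensor_opp -{2}[t]tensor_scale1 -tensor_scaleDl addNr.
elim/tensorW: t => u; rewrite tensor_scaleE.
exact/tensor_eqP/tensor_scale0_seq.
Qed.

HB.instance Definition _ := GRing.isZmodule.Build tensor
  tensor_addA tensor_addC tensor_add0 tensor_addN.

Lemma tensor_addpi u v : \pi_tensor (u ++ v) = \pi_tensor u + \pi_tensor v.
Proof. by rewrite -tensor_addE. Qed.

Lemma tensor_scaleA a b t :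
  tensor_scale a (tensor_scale b t) = tensor_scale (a * b) t.
Proof.
elim/tensorW: t => u; rewrite !tensor_scaleE /tensor_scale_seq -map_comp.
by congr (\pi_tensor _); apply: eq_map => -[m n] /=; rewrite scalerA.
Qed.
Lemma tensor_scaleDr : right_distributive tensor_scale +%R.
Proof.
move=> a x y; elim/tensorW: x => u; elim/tensorW: y => v.
rewrite -tensor_addpi !tensor_scaleE -tensor_addpi.
by rewrite /tensor_scale_seq map_cat.
Qed.

HB.instance Definition _ := GRing.Zmodule_isLmodule.Build k tensor
  tensor_scaleA tensor_scale1 tensor_scaleDr tensor_scaleDl.

Lemma tensor_scalepi a u :
  \pi_tensor (tensor_scale_seq a u) = a *: \pi_tensor u.
Proof. by rewrite -tensor_scaleE. Qed.

Definition pure (m : M) (n : N) : tensor := \pi_tensor [:: (m, n)].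

Lemma pure_is_bilinear : bilinear_for *:%R *:%R pure.
Proof.
split=> [n a m m' | m a n n']; rewrite /pure /=.
  rewrite -tensor_scalepi -tensor_addpi; exact/tensor_eqP/TRaddl.
rewrite -tensor_scalepi -tensor_addpi; apply/tensor_eqP.
apply: TRtrans (TRaddr _ _ _) _; rewrite -cat1s -[X in tensor_rel _ X]cat1s.
by apply: TRcat; [apply/TRsym/TRscale | apply: TRrefl].
Qed.

HB.instance Definition _ :=
  bilinear_isBilinear.Build k M N tensor *:%R *:%R pure pure_is_bilinear.

Lemma tensor_pureE (t : tensor) : t = \sum_(x <- repr t) pure x.1 x.2.
Proof.
rewrite -[LHS]reprK; elim: (repr t) => [|[m n] u IH] /=; first by rewrite big_nil.
by rewrite big_cons -cat1s tensor_addpi IH.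
Qed.

End TensorRelation.

Notation "M \ox N" := (tensor M N) : type_scope.
Notation "M \ox N" := (tensor M N) : ring_scope.
Notation "m \ot n" := (pure m n) : ring_scope.

Section TensorLift.
Variables (k : comNzRingType) (M N P : lmodType k).

(* For bilinear f, the linear map sending m \ot n to f m n.                   *)
Definition tlift (f : M -> N -> P) (t : M \ox N) : P :=
  \sum_(x <- repr t) f x.1 x.2.

Variable f : {bilinear M -> N -> P}.

Lemma tensor_rel_lift u v : tensor_rel u v ->
  \sum_(x <- u) f x.1 x.2 = \sum_(x <- v) f x.1 x.2.
Proof.
elim=> //=.
- by move=> u0 v0 w0 _ -> _ ->.
- by move=> ? ? ? ? _ + _ +; rewrite !big_cat /= => -> ->.
- by move=> ? ?; rewrite !big_cat /= addrC.
- by move=> n; rewrite big_seq1 big_nil linear0l.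
- by move=> m m' n; rewrite big_seq1 !big_cons big_nil addr0 linearDl.
- by move=> m n n'; rewrite big_seq1 !big_cons big_nil addr0 linearDr.
- by move=> a m n; rewrite !big_seq1 linearZl_LR linearZr_LR.
Qed.

Lemma tlift_pi u : tlift f (\pi_(M \ox N) u) = \sum_(x <- u) f x.1 x.2.
Proof. exact/tensor_rel_lift/tensor_reprP. Qed.

Lemma tlift_pure m n : tlift f (m \ot n) = f m n.
Proof. by rewrite tlift_pi big_seq1. Qed.

Lemma tlift_is_linear : linear (tlift f).
Proof.
move=> a x y; elim/tensorW: x => u; elim/tensorW: y => v.
rewrite -tensor_scalepi -tensor_addpi !tlift_pi.
rewrite big_cat /=; congr (_ + _).
by rewrite big_map scaler_sumr; apply: eq_bigr => x _; rewrite linearZl_LR.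
Qed.

HB.instance Definition _ :=
  GRing.isLinear.Build k (M \ox N)%type P *:%R (tlift f) tlift_is_linear.

End TensorLift.

Lemma tensor_linear_ext (k : comNzRingType) (M N P : lmodType k)
    (f g : {linear M \ox N -> P}) :
  (forall m n, f (m \ot n) = g (m \ot n)) -> f =1 g.
Proof.
move=> fg t; rewrite (tensor_pureE t) !linear_sum.
by apply: eq_bigr => x _; apply: fg.
Qed.

Section TensorMaps.
Variable k : comNzRingType.

Section Map.
Variables M N M' N' : lmodType k.

Definition pure_map (f : M -> M') (g : N -> N') (m : M) (n : N) : M' \ox N' :=
  f m \ot g n.
Definition tmap (f : M -> M') (g : N -> N') : M \ox N -> M' \ox N' :=
  tlift (pure_map f g).

Variables (f : {linear M -> M'}) (g : {linear N -> N'}).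
Lemma pure_map_bilinear : bilinear_for *:%R *:%R (pure_map f g).
Proof.
split=> [n a m m' | m a n n']; rewrite /pure_map linearP.
  by rewrite linearPl.
by rewrite linearPr.
Qed.
HB.instance Definition _ :=
  bilinear_isBilinear.Build k M N (M' \ox N')%type *:%R *:%R (pure_map f g)
    pure_map_bilinear.
HB.instance Definition _ := GRing.Linear.on (tmap f g).
Lemma tmapE m n : tmap f g (m \ot n) = f m \ot g n.
Proof. exact: tlift_pure. Qed.
End Map.

Section Assoc.
Variables M N P : lmodType k.

Definition pure_right (p : P) (m : M) (n : N) : M \ox (N \ox P) :=
  m \ot (n \ot p).
Lemma pure_right_bilinear p : bilinear_for *:%R *:%R (pure_right p).
Proof.
by split=> [n a m m' | m a n n']; rewrite /pure_right ?linearPl ?linearPr.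
Qed.
HB.instance Definition _ p :=
  bilinear_isBilinear.Build k M N (M \ox (N \ox P))%type *:%R *:%R (pure_right p)
    (pure_right_bilinear p).

Definition assoc_fun (t : M \ox N) (p : P) : M \ox (N \ox P) :=
  tlift (pure_right p) t.
Lemma assoc_fun_bilinear : bilinear_for *:%R *:%R assoc_fun.
Proof.
split=> [p a t t' | t a p p']; rewrite /assoc_fun; first by rewrite linearP.
rewrite /= /tlift scaler_sumr -big_split /=; apply: eq_bigr => x _.
by rewrite /pure_right !linearPr.
Qed.
HB.instance Definition _ :=
  bilinear_isBilinear.Build k (M \ox N)%type P (M \ox (N \ox P))%type *:%R *:%R
    assoc_fun assoc_fun_bilinear.
Definition tassoc : (M \ox N) \ox P -> M \ox (N \ox P) := tlift assoc_fun.
HB.instance Definition _ := GRing.Linear.on tassoc.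
Lemma tassocE m n p : tassoc ((m \ot n) \ot p) = m \ot (n \ot p).
Proof. by rewrite /tassoc tlift_pure /= /assoc_fun tlift_pure. Qed.

Definition pure_left (m : M) (n : N) (p : P) : (M \ox N) \ox P :=
  (m \ot n) \ot p.
Lemma pure_left_bilinear m : bilinear_for *:%R *:%R (pure_left m).
Proof.
by split=> [p a n n' | n a p p']; rewrite /pure_left ?linearPr ?linearPl.
Qed.
HB.instance Definition _ m :=
  bilinear_isBilinear.Build k N P ((M \ox N) \ox P)%type *:%R *:%R (pure_left m)
    (pure_left_bilinear m).

Definition unassoc_fun (m : M) (t : N \ox P) : (M \ox N) \ox P :=
  tlift (pure_left m) t.
Lemma unassoc_fun_bilinear : bilinear_for *:%R *:%R unassoc_fun.
Proof.
split=> [t a m m' | m a t t']; rewrite /unassoc_fun; last by rewrite linearP.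
rewrite /= /tlift scaler_sumr -big_split /=; apply: eq_bigr => x _.
by rewrite /pure_left !linearPl.
Qed.
HB.instance Definition _ :=
  bilinear_isBilinear.Build k M (N \ox P)%type ((M \ox N) \ox P)%type *:%R *:%R
    unassoc_fun unassoc_fun_bilinear.
Definition tunassoc : M \ox (N \ox P) -> (M \ox N) \ox P := tlift unassoc_fun.
HB.instance Definition _ := GRing.Linear.on tunassoc.
Lemma tunassocE m n p : tunassoc (m \ot (n \ot p)) = (m \ot n) \ot p.
Proof. by rewrite /tunassoc tlift_pure /= /unassoc_fun tlift_pure. Qed.
End Assoc.

Section Mul.
Variable A : algType k.
Definition mul_fun (a b : A) : A := a * b.
Lemma mul_fun_bilinear : bilinear_for *:%R *:%R mul_fun.
Proof.
split=> [b c a a' | a c b b']; rewrite /mul_fun /=.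
  by rewrite mulrDl scalerAl.
by rewrite mulrDr scalerAr.
Qed.
HB.instance Definition _ :=
  bilinear_isBilinear.Build k A A A *:%R *:%R mul_fun mul_fun_bilinear.
Definition tmul : A \ox A -> A := tlift mul_fun.
HB.instance Definition _ := GRing.Linear.on tmul.
Lemma tmulE a b : tmul (a \ot b) = a * b.
Proof. exact: tlift_pure. Qed.
End Mul.
End TensorMaps.

Arguments tmap {k M N M' N'} f g t.
Arguments tassoc {k M N P} t.
Arguments tunassoc {k M N P} t.
Arguments tmul {k A} t.

(* The associativity isomorphisms, implicit on paper, are inserted so that    *)
(* the two hexagons start at (C \ox C) \ox A and C \ox (A \ox A).             *)
Definition twisting_map (k : comNzRingType) (C A : algType k)
    (s : {linear C \ox A -> A \ox C}) : Prop :=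
  [/\ (forall a : A, s (1 \ot a) = a \ot 1) /\
      (forall c : C, s (c \ot 1) = 1 \ot c),
      forall t : (C \ox C) \ox A,
        s (tmap tmul idfun t) =
        tmap idfun tmul (tassoc (tmap s idfun (tunassoc
          (tmap idfun s (tassoc t)))))
    & forall t : C \ox (A \ox A),
        s (tmap idfun tmul t) =
        tmap tmul idfun (tunassoc (tmap idfun s (tassoc
          (tmap s idfun (tunassoc t)))))].

Section Gamma.
Variables (k : comNzRingType) (n : nat) (A : algType k).

(* For n > 0, k[y]/<y^n>; the class of y is 'qX. At n = 0 the library         *)
(* quotients by <y> instead.                                                  *)
Local Notation C := {poly %/ ('X^n : {poly k})}.

Definition coef_fun (j : nat) (a : A) (c : C) : A := (c : {poly k})`_j *: a.
Lemma coef_fun_bilinear j : bilinear_for *:%R *:%R (coef_fun j).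
Proof.
split=> [c b a a' | a b c c']; rewrite /coef_fun /=.
  by rewrite scalerDr !scalerA mulrC.
by rewrite coefD coefZ scalerDl scalerA.
Qed.
HB.instance Definition _ j :=
  bilinear_isBilinear.Build k A C A *:%R *:%R (coef_fun j) (coef_fun_bilinear j).

Definition tcoef (j : nat) : A \ox C -> A := tlift (coef_fun j).
HB.instance Definition _ j := GRing.Linear.on (tcoef j).

Lemma tcoefE j a (c : C) : tcoef j (a \ot c) = (c : {poly k})`_j *: a.
Proof. exact: tlift_pure. Qed.

Definition gamma (s : {linear C \ox A -> A \ox C}) (r j : nat) (a : A) : A :=
  tcoef j (s ('qX ^+ r \ot a)).

Hypothesis n_gt0 : (0 < n)%N.

Lemma size_modXn : size (mk_monic ('X^n : {poly k})) = n.+1.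
Proof. by rewrite mk_monic_Xn size_polyXn prednK. Qed.

Lemma qX_exp j : (j < n)%N -> ('qX ^+ j : C) = 'X^j :> {poly k}.
Proof.
move=> ltjn; rewrite /qpolyX -rmorphXn in_qpoly_small //.
by rewrite size_modXn size_polyXn ltnS.
Qed.

Lemma truncE (c : C) : c = \sum_(j < n) (c : {poly k})`_j *: 'qX ^+ j.
Proof.
apply/val_inj; rewrite /= poly_of_qpoly_sum; apply/polyP=> i.
rewrite coef_sum; have lec : (size c <= n)%N by rewrite -ltnS -size_modXn size_mk_monic.
under eq_bigr => j _ do rewrite poly_of_qpolyZ coefZ qX_exp // coefXn.
have [ltin|leni] := ltnP i n.
  rewrite (bigD1 (Ordinal ltin)) //= eqxx mulr1 big1 ?addr0 // => j.
  by rewrite -val_eqE /= eq_sym => /negPf->; rewrite mulr0.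
rewrite nth_default ?(leq_trans lec) // big1 // => j _.
by rewrite gtn_eqF ?mulr0 // (leq_trans _ leni).
Qed.

Lemma tcoef_sum (t : A \ox C) : t = \sum_(j < n) tcoef j t \ot 'qX ^+ j.
Proof.
have pP (u : A) : {morph @pure k A C u : c c' / c + c'}.
  by move=> c c'; apply: linearDr.
rewrite [LHS]tensor_pureE; under [RHS]eq_bigr => j _.
  rewrite {1}[t]tensor_pureE linear_sum linear_sumlz; over.
rewrite exchange_big /=; apply: eq_bigr => -[a c] _ /=.
rewrite {1}[c]truncE (big_morph _ (pP a) (linear0r _ _)).
by apply: eq_bigr => j _; rewrite tcoefE linearZr_LR linearZl_LR.
Qed.

Lemma tcoef_uniq (c : nat -> A) j : (j < n)%N ->
  tcoef j (\sum_(i < n) c i \ot 'qX ^+ i) = c j.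
Proof.
move=> ltjn; rewrite linear_sum (bigD1 (Ordinal ltjn)) //= big1 ?addr0.
  by rewrite tcoefE qX_exp // coefXn eqxx scale1r.
move=> i; rewrite -val_eqE /= => neq_ij.
by rewrite tcoefE qX_exp // coefXn eq_sym (negPf neq_ij) scale0r.
Qed.

(* gamma s is the family determined by                                        *)
(* s (y^r \ot a) = \sum_(j < n) gamma^r_j(a) \ot y^j.                         *)
Lemma gammaP (s : {linear C \ox A -> A \ox C}) (c : nat -> nat -> A -> A) :
  (forall r a, (r < n)%N ->
     s ('qX ^+ r \ot a) = \sum_(j < n) c r j a \ot 'qX ^+ j) <->
  (forall r j a, (r < n)%N -> (j < n)%N -> gamma s r j a = c r j a).
Proof.
split=> [sE r j a ltrn ltjn | gE r a ltrn].
  by rewrite /gamma sE // (tcoef_uniq (fun j => c r j a)).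
by rewrite [LHS]tcoef_sum; apply: eq_bigr => j _; rewrite -gE.
Qed.

End Gamma.

Definition kernel (k : comNzRingType) (A : algType k) (f : A -> A) : {pred A} :=
  [pred a | f a == 0].

(* Main.v *)
Require Import Defs.
From HB Require Import structures.
From mathcomp Require Import all_boot all_order all_algebra.
From mathcomp Require Import boolp.

(** Write D = g_0, B = ker D and N = n / h.  Evaluated on the powers of y, the
    axioms of a twisting map say that its coefficient maps satisfy
      y^r a = sum_j gamma^r_j(a) y^j
    compatibly with products in A and with y^n = 0 ([twistingP]).

    Dividing the elements D^(h-1-j)(x) by the unit q gives a Jordan chain e_j,
    j < h, with D^j(e_j) = 1; since q^-1 lies in B, the e_j span A over B
    ([kernel_linear_chain]).  Both halves of the theorem solve unitriangular
    systems indexed by this chain.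

    Existence.  The coefficient maps are read off from a concrete operator.
    Let y act on A[z]/(z^N), linearly over B[z], in such a way that it reduces
    to D modulo z and that y(1) = z e_(h-1) modulo z^2.  As D^h = 0, y^h sends
    everything into the multiples of z, so y^n = 0; the condition on y(1)
    makes y^h(1) equal to z up to higher order.  Hence the matrix of the
    values y^(lh+i)(e_i'), ordered by z-degree and then along the chain, is
    unitriangular, and every B[z]-linear operator is uniquely a combination
    sum_(j < n) c_j y^j with c_j in A ([deformation_basis],
    [deformation_inj]).  Expanding the operators y^r a in this way defines
    gamma^r_j, and associativity of composition gives the equations of a
    twisting family ([structure_twisting_family]).  It remains to reach the
    prescribed maps g_l.  If H is B-linear and H(1) = 0, replacing y by
    y + z^l H, l > 0, changes neither gamma^1_j for j < lh nor the values
    y^j(1) modulo z^(l+1), and it adds H to gamma^1_(lh)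
    ([adjusted_structure]).  So the g_l can be installed one after the other
    ([deformation_exists]).  Elements of B commute with y, which gives
    s(c (x) b) = b (x) c.

    Uniqueness.  In any solution, the product rule in degree 0 applied to the
    products a e_m forces gamma^h_j = 0 for j < h ([family_pow_h]); therefore
    gamma^r_j = 0 whenever j < lh <= r, and gamma^(lh+i)_(lh) equals
    gamma^(lh)_(lh) composed with D^i ([family_diag]).  In the product rule in
    degree lh for a e_m the unknowns gamma^1_(lh+i)(a), 0 <= i < h, thus occur
    with a unitriangular matrix, and every other term involves only
    gamma^1_j with j <= lh ([family_unique]). *)

Set Implicit Arguments.
Unset Strict Implicit.
Unset Printing Implicit Defensive.

Import GRing.Theory.
Local Open Scope ring_scope.

(** * Families of coefficient maps *)

(** The equations that the axioms of a twisting map impose on the maps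
    gamma^r_j.  The exponent r runs over all natural numbers, so that the
    relation y^n = 0 becomes the last clause and the composition rule holds
    without a bound on r + q. *)
Definition twisting_family (A : nzRingType) (n : nat)
    (gam : nat -> nat -> A -> A) : Prop :=
  [/\ forall j a, (j < n)%N -> gam 0%N j a = if j == 0%N then a else 0,
      forall r j, (r < n)%N -> (j < n)%N -> gam r j 1 = (r == j)%:R,
      forall r q j a, (j < n)%N ->
        gam (r + q)%N j a = \sum_(i < j.+1) gam r (j - i)%N (gam q i a),
      forall r j a b, (j < n)%N ->
        gam r j (a * b) = \sum_(i < n) gam r i a * gam i j b
    & forall r j a, (n <= r)%N -> (j < n)%N -> gam r j a = 0].

Lemma eq_twisting_family (A : nzRingType) n (gam gam' : nat -> nat -> A -> A) :
    (forall r j, (j < n)%N -> gam r j =1 gam' r j) ->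
  twisting_family n gam -> twisting_family n gam'.
Proof.
move=> E [g0 g1 gC gM gn].
split=> [j a ltj|r j ltr ltj|r q j a ltj|r j a b ltj|].
- by rewrite -E // g0.
- by rewrite -E // g1.
- rewrite -E // gC //; apply: eq_bigr => i _.
  by rewrite !E // ?(leq_ltn_trans (leq_subr _ _)) // (leq_trans (ltn_ord i)).
- rewrite -E // gM //; apply: eq_bigr => i _.
  by rewrite !E // ltn_ord.
- by move=> r j a ler ltj; rewrite -E // gn.
Qed.

(** * Unitriangular systems and convolution sums *)

Section TriangularSystems.
Variable A : nzRingType.

(** The coefficients stand on the left because A need not be commutative.  The
    first p of them are already known to vanish; the equations then kill the
    next d, one at a time, and carry no information on the remaining n - p - d,
    which meet only zero entries of T. *)
Lemma unitriangular_zero (p d n : nat) (c : nat -> A) (T : nat -> nat -> A) :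
    (p + d <= n)%N ->
    (forall i, (i < p)%N -> c i = 0) ->
    (forall i m, (m < d)%N -> (p + m < i)%N -> T i m = 0) ->
    (forall m, (m < d)%N -> T (p + m)%N m = 1) ->
    (forall m, (m < d)%N -> \sum_(i < n) c i * T i m = 0) ->
  forall i, (i < p + d)%N -> c i = 0.
Proof.
move=> le_pd_n c_lo T_lo T_diag sum0; elim/ltn_ind=> i IH lt_i.
have [lt_ip|le_pi] := ltnP i p; first exact: c_lo.
have lt_md : (i - p < d)%N by rewrite ltn_subLR.
have Ei : (p + (i - p))%N = i by rewrite subnKC.
have := sum0 _ lt_md; rewrite (bigD1 (Ordinal (leq_trans lt_i le_pd_n))) //=.
rewrite -{2}Ei T_diag // mulr1 big1 ?addr0 // => j.
rewrite -val_eqE /= => ne_ji.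
have [lt_ji|lt_ij|eq_ji] := ltngtP j i; last by rewrite eq_ji eqxx in ne_ji.
  by rewrite IH ?mul0r // (ltn_trans lt_ji).
by rewrite T_lo ?mulr0 // Ei.
Qed.

Lemma unitriangular_solve (T : nat -> nat -> A) (v : nat -> A) :
    (forall j m, (m < j)%N -> T j m = 0) -> (forall j, T j j = 1) ->
  forall n, exists c : nat -> A,
    forall m, (m < n)%N -> \sum_(j < n) c j * T j m = v m.
Proof.
move=> T_lo T_diag; elim=> [|n [c cP]]; first by exists (fun=> 0).
pose d := v n - \sum_(j < n) c j * T j n.
exists (fun j => if j == n then d else c j) => m.
rewrite big_ord_recr /= eqxx.
under eq_bigr => j _ do rewrite ltn_eqF //.
rewrite ltnS leq_eqVlt => /predU1P[->|lt_mn].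
  by rewrite T_diag mulr1 addrC subrK.
by rewrite cP // T_lo // mulr0 addr0.
Qed.

End TriangularSystems.

Lemma sum_convolution (V : nmodType) (n : nat) (G : nat -> nat -> V) :
  \sum_(i < n) \sum_(l < n | (l + i < n)%N) G l i =
  \sum_(j < n) \sum_(i < j.+1) G (j - i)%N i.
Proof.
transitivity (\sum_(j < n) \sum_(i < n | (i <= j)%N) G (j - i)%N i); last first.
  apply: eq_bigr => j _; rewrite (big_ord_widen n (fun i => G (j - i)%N i)) //.
rewrite [RHS](exchange_big_dep xpredT) //=; apply: eq_bigr => i _.
transitivity (\sum_(i <= j < n) G (j - i)%N i); last first.
  by rewrite (big_nat_widenl i 0) // big_mkord.
rewrite -[X in \sum_(X <= _ < _) _]add0n big_addn big_mkord.
under [RHS]eq_bigr => j _ do rewrite addnK.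
rewrite (big_ord_widen n (fun j => G j i)) ?leq_subr //.
by apply: eq_bigl => l; rewrite ltn_subRL addnC.
Qed.

(** * Polynomials modulo a power of the variable *)

Section Truncation.
Variable A : nzRingType.
Implicit Types u v w : {poly A}.

(** Congruence modulo z^N.  Working with congruences in A[z] instead of the
    quotient A[z]/(z^N) makes the reductions between different exponents N
    trivial. *)
Definition eqmodX (N : nat) u v := exists w, u = v + w * 'X^N.

Lemma eqmodXP N u v :
  eqmodX N u v <-> forall i, (i < N)%N -> u`_i = v`_i.
Proof.
split=> [[w ->] i ltiN | uv]; first by rewrite coefD coefMXn ltiN addr0.
exists (drop_poly N (u - v)); apply/eqP; rewrite addrC -subr_eq; apply/eqP.
rewrite -[LHS](poly_take_drop N) (_ : take_poly N _ = 0) ?add0r //.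
apply/polyP=> i; rewrite coef_take_poly coef0; case: ifP => // ltiN.
by rewrite coefB uv // subrr.
Qed.

Lemma eqmodX_sub N u v : eqmodX N u v <-> eqmodX N (u - v) 0.
Proof.
rewrite !eqmodXP; split=> uv i ltiN; first by rewrite coefB uv // subrr coef0.
by apply/eqP; rewrite -subr_eq0 -coefB uv // coef0.
Qed.

Lemma eqmodX_eq N u v : u = v -> eqmodX N u v.
Proof. by move->; apply/eqmodXP. Qed.

Lemma eqmodX_sym N u v : eqmodX N u v -> eqmodX N v u.
Proof. by move/eqmodXP=> uv; apply/eqmodXP => i /uv. Qed.

Lemma eqmodX_trans N u v w : eqmodX N u v -> eqmodX N v w -> eqmodX N u w.
Proof.
move=> /eqmodXP uv /eqmodXP vw; apply/eqmodXP => i ltiN.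
by rewrite uv // vw.
Qed.

Lemma eqmodX_le N N' u v : (N' <= N)%N -> eqmodX N u v -> eqmodX N' u v.
Proof.
move=> leN /eqmodXP uv; apply/eqmodXP => i lti; exact: uv (leq_trans lti leN).
Qed.

Lemma eqmodX_sum N (I : finType) (F G : I -> {poly A}) :
  (forall i, eqmodX N (F i) (G i)) ->
  eqmodX N (\sum_i F i) (\sum_i G i).
Proof.
move=> FG; apply/eqmodXP => i ltiN; rewrite !coef_sum.
by apply: eq_bigr => j _; have /eqmodXP-> := FG j.
Qed.

Lemma eqmodX_mulC N a u v : eqmodX N u v -> eqmodX N (a%:P * u) (a%:P * v).
Proof.
by move=> /eqmodXP uv; apply/eqmodXP => i ltiN; rewrite !coefCM uv.
Qed.

End Truncation.

(** * Operators linear over the kernel of D *)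

Section KernelLinear.
Variables (A : nzRingType) (D : {additive A -> A}).

Definition kernel_linear (f : A -> A) :=
  {morph f : a b / a + b} /\ forall b a, D b = 0 -> f (b * a) = b * f a.

(** Linearity over (ker D)[z].  Such an operator is determined by its values on
    constants, and each coefficient of these values is ker D-linear in the
    constant. *)
Definition series_linear (f : {poly A} -> {poly A}) :=
  [/\ {morph f : u v / u + v}, forall u, f (u * 'X) = f u * 'X
    & forall b u, D b = 0 -> f (b%:P * u) = b%:P * f u].

Lemma kernel_linear0 f : kernel_linear f -> f 0 = 0.
Proof. by case=> fD _; apply: (addrI (f 0)); rewrite -fD !addr0. Qed.

Lemma series_linear0 f : series_linear f -> f 0 = 0.
Proof. by case=> fD _ _; apply: (addrI (f 0)); rewrite -fD !addr0. Qed.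

Lemma series_linear_sum f n (F : nat -> {poly A}) : series_linear f ->
  f (\sum_(i < n) F i) = \sum_(i < n) f (F i).
Proof.
move=> fL; have [fD _ _] := fL.
exact: (big_morph f fD (series_linear0 fL)).
Qed.

Lemma series_linearXn f n u : series_linear f -> f (u * 'X^n) = f u * 'X^n.
Proof.
case=> _ fX _; elim: n => [|n IH]; first by rewrite !mulr1.
by rewrite exprSr !mulrA fX IH.
Qed.

Lemma series_linear_eqmodX f N u v :
  series_linear f -> eqmodX N u v -> eqmodX N (f u) (f v).
Proof.
move=> fL [w ->]; exists (f w); have [fD _ _] := fL.
by rewrite fD series_linearXn.
Qed.

Lemma series_linear_iter f j : series_linear f -> series_linear (iter j f).
Proof.
case=> fD fX fB; elim: j => [|j [jD jX jB]]; first by split.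
by split=> [u v|u|b u Db0]; rewrite !iterS ?jD ?jX ?jB // ?fD ?fX ?fB.
Qed.

Lemma series_linear_comp f f' :
  series_linear f -> series_linear f' -> series_linear (f \o f').
Proof.
move=> [fD fX fB] [f'D f'X f'B].
by split=> [u v|u|b u Db0] /=; rewrite ?f'D ?f'X ?f'B // ?fD ?fX ?fB.
Qed.

Lemma series_linear_sub f f' :
  series_linear f -> series_linear f' -> series_linear (fun u => f u - f' u).
Proof.
move=> [fD fX fB] [f'D f'X f'B]; split=> [u v|u|b u Db0].
- by rewrite fD f'D opprD addrACA.
- by rewrite fX f'X mulrBl.
- by rewrite fB // f'B // mulrBr.
Qed.

Lemma series_linear_big n (F : nat -> {poly A} -> {poly A}) :
    (forall i, series_linear (F i)) ->
  series_linear (fun u => \sum_(i < n) F i u).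
Proof.
move=> FL; split=> [u v|u|b u Db0].
- by rewrite -big_split; apply: eq_bigr => i _; case: (FL i) => ->.
- by rewrite mulr_suml; apply: eq_bigr => i _; case: (FL i) => _ ->.
- by rewrite mulr_sumr; apply: eq_bigr => i _; case: (FL i) => _ _ ->.
Qed.

Hypothesis kerC : forall b a, D b = 0 -> b * a = a * b.

Lemma series_linear_mulC a : series_linear (fun u => a%:P * u).
Proof.
split=> [u v|u|b u Db0]; [exact: mulrDr | by rewrite mulrA |].
by rewrite !mulrA -!polyCM (kerC a Db0).
Qed.

Lemma series_linear_map f : kernel_linear f -> series_linear (map_poly f).
Proof.
move=> fL; have f0 := kernel_linear0 fL; have [fD fB] := fL.
split=> [u v|u|b u Db0]; apply/polyP=> i.
- by rewrite coefD !coef_map_id0 // coefD fD.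
- by rewrite coefMX !coef_map_id0 // coefMX; case: eqP.
- by rewrite coefCM !coef_map_id0 // coefCM fB.
Qed.

End KernelLinear.

(** * Jordan chains *)

Section JordanChain.
Variables (A : nzRingType) (D : {additive A -> A}) (h : nat) (e : nat -> A).
Hypothesis D_lin : kernel_linear D D.
Hypothesis D_nilp : forall a, iter h D a = 0.
Hypothesis D1 : D 1 = 0.
Hypothesis eP : forall j, (j < h)%N -> iter j D (e j) = 1.

Lemma iter_D0 i : iter i D 0 = 0.
Proof. by elim: i => //= i ->; rewrite raddf0. Qed.

Lemma iter_De i m : (m < h)%N -> (m < i)%N -> iter i D (e m) = 0.
Proof.
move=> lt_mh lt_mi; rewrite -(subnK lt_mi) addnS -addSn iterD eP // iterSr D1.
exact: iter_D0.
Qed.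

Lemma iter_D_sub i : {morph iter i D : a b / a - b}.
Proof. by move=> a b; elim: i => //= i ->; rewrite raddfB. Qed.

Lemma iter_D_linear i b a : D b = 0 -> iter i D (b * a) = b * iter i D a.
Proof. by move=> Db0; elim: i => //= i ->; rewrite (proj2 D_lin). Qed.

(** The e_j, j < h, span A over B = ker D: if D^(j+1)(a) = 0 then b = D^j(a)
    lies in B, and a - b e_j is killed by D^j already. *)
Lemma kernel_linear_chain f : kernel_linear D f ->
  (forall i, (i < h)%N -> f (e i) = 0) -> forall a, f a = 0.
Proof.
move=> fL fe0; have [fD fB] := fL.
suff H j a : (j <= h)%N -> iter j D a = 0 -> f a = 0.
  by move=> a; apply: (H h).
elim: j a => [|j IH] a lejh Da0; first by rewrite [a]Da0 (kernel_linear0 fL).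
pose b := iter j D a; have Db0 : D b = 0 by [].
rewrite -[a](subrK (b * e j)) fD fB // fe0 // mulr0 addr0.
apply: IH; first exact: ltnW.
by rewrite iter_D_sub iter_D_linear // eP // mulr1 subrr.
Qed.

Lemma series_linear_chain N f : series_linear D f ->
    (forall i, (i < h)%N -> eqmodX N (f (e i)%:P) 0) ->
  forall u, eqmodX N (f u) 0.
Proof.
move=> fL fe0; have [fD fX fB] := fL.
elim/poly_ind=> [|u a [w Ew]].
  by rewrite (series_linear0 fL); exists 0; rewrite mul0r addr0.
have [w' Ew'] : eqmodX N (f a%:P) 0.
  apply/eqmodXP=> i ltiN; rewrite coef0.
  apply: (@kernel_linear_chain (fun c => (f c%:P)`_i)) => [|j ltj].
    split=> [c d|b c Db0]; first by rewrite polyCD fD coefD.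
    by rewrite polyCM fB // coefCM.
  by have /eqmodXP-> := fe0 j ltj; rewrite ?coef0.
exists (w * 'X + w').
rewrite fD fX Ew Ew' !add0r mulrDl; congr (_ + _).
by rewrite -!mulrA; congr (_ * _); rewrite -exprS exprSr.
Qed.

(** * Deformations of D and the basis of their powers *)

Section Deformation.
Hypothesis h_gt1 : (1 < h)%N.
Hypothesis kerC : forall b a, D b = 0 -> b * a = a * b.
Let h_gt0 : (0 < h)%N := ltnW h_gt1.

Lemma chain0 : e 0 = 1. Proof. exact: (eP h_gt0). Qed.

(** An operator y on A[z] that reduces to D modulo z.  The condition on y(1)
    makes h applications of y send 1 to z, up to higher order, along the chain
    z e_(h-1), z e_(h-2), ..., z e_0 = z. *)
Definition deformation (y : {poly A} -> {poly A}) :=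
  [/\ series_linear D y, forall u, (y u)`_0 = D u`_0 & (y 1)`_1 = e h.-1].

Section Basis.
Variable y : {poly A} -> {poly A}.
Hypothesis yP : deformation y.
Let yL : series_linear D y. Proof. by case: yP. Qed.
Let yjL j : series_linear D (iter j y).
Proof. exact: series_linear_iter. Qed.

Lemma deformation_coef0 j u : (iter j y u)`_0 = iter j D u`_0.
Proof. by elim: j => //= j <-; case: yP => _ ->. Qed.

(** Modulo z the operator y^h is D^h = 0; hence each factor y^h gains a factor
    z. *)
Lemma deformation_pow0 l u : eqmodX l (iter (l * h) y u) 0.
Proof.
elim: l u => [|l IH] u; first by apply/eqmodXP.
rewrite mulSn iterD; have [w ->] := IH u; rewrite add0r.
rewrite (series_linearXn _ _ (yjL h)); apply/eqmodXP=> i.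
rewrite ltnS coefMXn coef0 leq_eqVlt; case: ltngtP => //= -> _.
by rewrite subnn deformation_coef0 D_nilp.
Qed.

Lemma deformation_pow_sub l j u : (l * h <= j)%N -> eqmodX l (iter j y u) 0.
Proof. by move=> /subnKC<-; rewrite iterD; apply: deformation_pow0. Qed.

(** The leading term of y^(lh)(1) is z^l. *)
Lemma deformation_pow1 l : eqmodX l.+1 (iter (l * h) y 1) 'X^l.
Proof.
have y1 : eqmodX 2 (iter h y 1) 'X.
  have [w Ew] : eqmodX 2 (y 1) ((e h.-1)%:P * 'X).
    have [_ y0 y11] := yP.
    by apply/eqmodXP=> -[|[|i]] // _; rewrite coefMX ?y0 ?coefC //= D1.
  rewrite -(prednK h_gt0) iterSr Ew.
  have [kD kX kB] := yjL h.-1; rewrite kD kX (series_linearXn _ _ (yjL _)).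
  apply/eqmodXP=> i lti; rewrite coefD coefMXn lti addr0 coefMX coefX.
  case: i lti => [|[|i]] //= _.
  by rewrite deformation_coef0 coefC eP // prednK.
elim: l => [|l [w Ew]]; first by apply/eqmodXP.
rewrite mulSn iterD Ew; have [hD _ _] := yjL h; rewrite hD.
(* the rest w z^(l+1) of y^(lh)(1) gains one more factor z under y^h *)
rewrite -['X^l in X in eqmodX _ X _]mul1r !(series_linearXn _ _ (yjL h)).
have [v ->] := y1.
have [v' ->] : eqmodX 1 (iter h y w) 0.
  by apply: deformation_pow_sub; rewrite mul1n.
exists (v + v'); rewrite add0r !mulrDl -!mulrA -!exprD -exprS -addrA.
by [].
Qed.

(** The index m = l h + i stands for the coordinate of z^l at the i-th element
    of the chain; the row j holds values of y^j. *)
Definition chain_matrix (j m : nat) : A :=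
  (iter j y (e (m %% h))%:P)`_(m %/ h).

(** Either the z-degree m / h is below the order j / h of y^j, or both agree and
    then y^(j mod h), which is a power of D modulo z, annihilates
    e_(m mod h). *)
Lemma chain_matrix_low j m : (m < j)%N -> chain_matrix j m = 0.
Proof.
move=> lt_mj; rewrite /chain_matrix.
have [lt_l|le_l] := ltnP (m %/ h) (j %/ h).
  have le_j := leq_trunc_div j h.
  by have /eqmodXP-> := deformation_pow_sub (e (m %% h))%:P le_j;
    rewrite ?coef0.
have {le_l} El : (m %/ h)%N = (j %/ h)%N.
  by apply/eqP; rewrite eqn_leq le_l andbT; apply: leq_div2r (ltnW lt_mj).
have lt_i : (m %% h < j %% h)%N.
  by rewrite -(ltn_add2l (m %/ h * h)) {2}El -!divn_eq.
rewrite {1}(divn_eq j h) El iterD.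
have [w ->] : eqmodX 1 (iter (j %% h) y (e (m %% h))%:P) 0.
  apply/eqmodXP=> -[|//] _; rewrite coef0 deformation_coef0 coefC.
  by rewrite iter_De // ltn_mod.
rewrite add0r (series_linearXn _ _ (yjL _)) coefMXn; case: ltnP => // le1.
have /eqmodXP-> := deformation_pow0 (j %/ h) w; first exact: coef0.
by rewrite subn1 prednK.
Qed.

Lemma chain_matrix_diag j : chain_matrix j j = 1.
Proof.
rewrite /chain_matrix {1}(divn_eq j h) iterD.
have [w ->] : eqmodX 1 (iter (j %% h) y (e (j %% h))%:P) 1.
  apply/eqmodXP=> -[|//] _; rewrite coef1 deformation_coef0 coefC.
  by rewrite eP // ltn_mod.
have [kD _ _] := yjL (j %/ h * h).
rewrite kD (series_linearXn _ _ (yjL _)) coefD.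
have /eqmodXP-> // := deformation_pow1 (j %/ h); rewrite coefXn eqxx.
rewrite coefMXn; case: ltnP => [|le1]; first by rewrite addr0.
have /eqmodXP-> := deformation_pow0 (j %/ h) w; first by rewrite coef0 addr0.
by rewrite subn1 prednK.
Qed.

(** Modulo z^N an operator is determined by the first N coefficients of its
    values on the chain, and these can be matched by solving the unitriangular
    system. *)
Lemma deformation_basis N f : series_linear D f -> exists c : nat -> A,
  forall u, eqmodX N (f u) (\sum_(j < N * h) (c j)%:P * iter j y u).
Proof.
move=> fL; pose v m := (f (e (m %% h))%:P)`_(m %/ h).
have [c cP] := unitriangular_solve v chain_matrix_low chain_matrix_diag (N * h).
exists c => u; apply/eqmodX_sub.
pose F j u := (c j)%:P * iter j y u.
apply: (@series_linear_chain N (fun u => f u - \sum_(j < N * h) F j u)) u.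
  apply: series_linear_sub => //; apply: series_linear_big => j.
  by apply: series_linear_comp (yjL j); apply: series_linear_mulC.
move=> i lt_ih /=; apply: (proj1 (eqmodX_sub N _ _)); apply/eqmodXP => l lt_lN.
have lt_m : (l * h + i < N * h)%N.
  by rewrite -(leq_pmul2r h_gt0) in lt_lN; apply: leq_trans lt_lN;
    rewrite mulSn addnC ltn_add2r.
have := cP _ lt_m; rewrite /v /chain_matrix divnMDl // divn_small // addn0.
rewrite modnMDl modn_small // => <-; rewrite coef_sum.
by apply: eq_bigr => j _; rewrite coefCM.
Qed.

Lemma deformation_free N n (c : nat -> A) : (N * h <= n)%N ->
  (forall u, eqmodX N (\sum_(j < n) (c j)%:P * iter j y u) 0) ->
  forall j, (j < N * h)%N -> c j = 0.
Proof.
move=> leNn cP; apply: (@unitriangular_zero _ 0 (N * h) n _ chain_matrix) => //.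
- by move=> i m _; apply: chain_matrix_low.
- by move=> m _; apply: chain_matrix_diag.
move=> m; rewrite -ltn_divLR // => lt_m.
have /eqmodXP cPm := cP (e (m %% h))%:P.
apply: etrans (etrans (cPm _ lt_m) (coef0 _ _)); rewrite coef_sum.
by apply: eq_bigr => j _; rewrite coefCM.
Qed.

(** The number n of powers may exceed N h, since y^j vanishes modulo z^N for
    j >= N h; this allows comparing expansions of length n at a lower precision
    z^N. *)
Lemma deformation_inj N n (c c' : nat -> A) : (N * h <= n)%N ->
  (forall u, eqmodX N (\sum_(j < n) (c j)%:P * iter j y u)
                      (\sum_(j < n) (c' j)%:P * iter j y u)) ->
  forall j, (j < N * h)%N -> c j = c' j.
Proof.
move=> leNn cc' j ltj; apply/eqP; rewrite -subr_eq0; apply/eqP.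
apply: (@deformation_free N n (fun j => c j - c' j)) => // u.
have /eqmodX_sub := cc' u; rewrite -sumrB; apply: eqmodX_trans.
apply/eqmodXP=> i _; rewrite !coef_sum; apply: eq_bigr => t _.
by rewrite coefB !coefCM mulrBl.
Qed.

(** ** Structure constants of a deformation *)

Section Coefficients.
Variables (N : nat) (gam : nat -> nat -> A -> A).

(** The commutation rule y^r a = sum_j gamma^r_j(a) y^j modulo z^N, as an
    identity between operators. *)
Definition structure_constants := forall r a u,
  eqmodX N (iter r y (a%:P * u))
           (\sum_(j < N * h) (gam r j a)%:P * iter j y u).

Hypothesis gamP : structure_constants.

Lemma structure_unique r a (c : nat -> A) :
    (forall u, eqmodX N (iter r y (a%:P * u))
                        (\sum_(j < N * h) (c j)%:P * iter j y u)) ->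
  forall j, (j < N * h)%N -> gam r j a = c j.
Proof.
move=> cP; apply: (@deformation_inj N (N * h)) => // u.
exact: eqmodX_trans (eqmodX_sym (gamP r a u)) (cP u).
Qed.

Lemma structureD r j : (j < N * h)%N -> {morph gam r j : a b / a + b}.
Proof.
move=> ltj a b.
apply: (@structure_unique r _ (fun j => gam r j a + gam r j b)) => // u.
rewrite polyCD mulrDl; have [yD _ _] := yjL r; rewrite yD.
under eq_bigr => i _ do rewrite polyCD mulrDl.
rewrite big_split /=; have [w ->] := gamP r a u; have [w' ->] := gamP r b u.
by exists (w + w'); rewrite addrACA mulrDl.
Qed.

Lemma structure_kernel r j b a : (j < N * h)%N -> D b = 0 ->
  gam r j (b * a) = b * gam r j a.
Proof.
move=> ltj Db0; apply: (@structure_unique r _ (fun j => b * gam r j a)) => // u.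
rewrite polyCM -mulrA; have [_ _ yB] := yjL r; rewrite yB //.
under eq_bigr => i _ do rewrite polyCM -mulrA.
rewrite -mulr_sumr; exact: eqmodX_mulC.
Qed.

(** Elements of ker D commute with y. *)
Lemma structure_kernel1 r j b : (j < N * h)%N -> D b = 0 ->
  gam r j b = if r == j then b else 0.
Proof.
move=> ltj Db0.
apply: (@structure_unique r _ (fun j => if r == j then b else 0)) => // u.
have [_ _ yB] := yjL r; rewrite yB //; have [ltr|ler] := ltnP r (N * h).
  rewrite (bigD1 (Ordinal ltr)) //= eqxx big1 ?addr0; last first.
    by move=> i; rewrite -val_eqE eq_sym /= => /negPf->; rewrite mul0r.
  by apply/eqmodXP.
rewrite big1 => [|i _]; last by rewrite gtn_eqF ?mul0r // (leq_trans _ ler).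
by rewrite -(mulr0 b%:P); apply/eqmodX_mulC/deformation_pow_sub.
Qed.

Lemma structure0 j a : (j < N * h)%N -> gam 0 j a = if j == 0 then a else 0.
Proof.
move=> ltj.
apply: (@structure_unique 0 _ (fun j => if j == 0 then a else 0)) => // u.
case: (N * h)%N ltj => // n _; rewrite big_ord_recl /= big1 ?addr0; last first.
  by move=> i _; rewrite mul0r.
by apply/eqmodXP.
Qed.

Lemma structure_nilp r j a : (j < N * h)%N -> (N * h <= r)%N -> gam r j a = 0.
Proof.
move=> ltj ler; apply: (@structure_unique r _ (fun=> 0)) => // u.
by rewrite big1 => [|i _]; [apply: deformation_pow_sub | rewrite mul0r].
Qed.

(** Both sides expand y^r a b, the right one by moving y^r past a and then the
    resulting powers past b. *)
Lemma structure_mul r j a b : (j < N * h)%N ->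
  gam r j (a * b) = \sum_(i < N * h) gam r i a * gam i j b.
Proof.
move=> ltj; pose c j := \sum_(i < N * h) gam r i a * gam i j b.
apply: (@structure_unique r _ c) => // u.
rewrite polyCM -mulrA; apply: eqmodX_trans (gamP r a _) _.
apply: (@eqmodX_trans _ _ _ (\sum_(i < N * h)
   (gam r i a)%:P * \sum_(t < N * h) (gam i t b)%:P * iter t y u)).
  by apply: eqmodX_sum => i; apply/eqmodX_mulC/gamP.
apply: eqmodX_eq; under [LHS]eq_bigr => i _ do rewrite mulr_sumr.
rewrite exchange_big; apply: eq_bigr => t _.
rewrite /c rmorph_sum mulr_suml; apply: eq_bigr => i _.
by rewrite mulrA -polyCM.
Qed.

(** Both sides expand y^r y^s a; the terms y^(l+i) with l + i >= N h vanish
    modulo z^N, which turns the double sum into a convolution. *)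
Lemma structure_comp r s j a : (j < N * h)%N ->
  gam (r + s) j a = \sum_(i < j.+1) gam r (j - i) (gam s i a).
Proof.
move=> ltj; pose c j := \sum_(i < j.+1) gam r (j - i) (gam s i a).
apply: (@structure_unique (r + s) _ c) => // u.
rewrite iterD.
apply: eqmodX_trans (series_linear_eqmodX (yjL r) (gamP s a u)) _.
rewrite (series_linear_sum _ (fun i => (gam s i a)%:P * iter i y u) (yjL r)).
pose G l i := (gam r l (gam s i a))%:P * iter (l + i) y u.
apply: (@eqmodX_trans _ _ _ (\sum_(i < N * h) \sum_(l < N * h) G l i)).
  apply: eqmodX_sum => i.
  apply: eqmodX_trans (gamP r _ _) _; apply/eqmodXP=> p _.
  by rewrite !coef_sum; apply: eq_bigr => l _; rewrite /G iterD.
apply: (@eqmodX_trans _ _ _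
          (\sum_(i < N * h) \sum_(l < N * h | (l + i < N * h)%N) G l i)).
  apply: eqmodX_sum => i.
  rewrite [X in eqmodX _ _ X]big_mkcond /=.
  apply: eqmodX_sum => l.
  case: ltnP => [_|le]; first by apply/eqmodXP.
  rewrite -(mulr0 (gam r l (gam s i a))%:P).
  exact/eqmodX_mulC/deformation_pow_sub.
rewrite sum_convolution; apply: eqmodX_eq.
apply: eq_bigr => t _; rewrite /c rmorph_sum mulr_suml.
by apply: eq_bigr => i _; rewrite /G subnK // -ltnS.
Qed.

Lemma structure_twisting_family : twisting_family (N * h) gam.
Proof.
split.
- exact: structure0.
- move=> r j ltr ltj; rewrite structure_kernel1 //; by case: eqP.
- exact: structure_comp.
- exact: structure_mul.
- by move=> r j a ler ltj; apply: structure_nilp.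
Qed.

(** Evaluation at 1 = e_0: the only coordinates used are those with index a
    multiple of h, which is how the maps gamma^r_(lh) are singled out. *)
Lemma structure_coef_row r a l : (l < N)%N ->
  (iter r y a%:P)`_l = \sum_(j < N * h) gam r j a * chain_matrix j (l * h).
Proof.
move=> ltl; have := gamP r a 1; rewrite mulr1 => /eqmodXP-> //.
rewrite coef_sum; apply: eq_bigr => j _.
by rewrite coefCM /chain_matrix modnMl mulnK // chain0.
Qed.

End Coefficients.

Lemma structure_constants_exist N : exists gam, structure_constants N gam.
Proof.
have H (p : nat * A) : exists c : nat -> A, forall u,
    eqmodX N (iter p.1 y (p.2%:P * u)) (\sum_(j < N * h) (c j)%:P * iter j y u).
  apply: (@deformation_basis N (fun u => iter p.1 y (p.2%:P * u))).
  exact: series_linear_comp (yjL _) (series_linear_mulC kerC _).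
have [c cP] := choice H.
by exists (fun r j a => c (r, a) j) => r a u; apply: (cP (r, a)).
Qed.

End Basis.

(** The coefficient of z in y may be any B-linear map sending 1 to e_(h-1);
    right multiplication by e_(h-1) is one. *)
Lemma deformation_base : exists y, deformation y.
Proof.
exists (fun u => map_poly D u + u * ((e h.-1)%:P * 'X)); split.
- have [mD mX mB] := series_linear_map D_lin; split=> [u v|u|b u Db0].
  + by rewrite mD mulrDl addrACA.
  + rewrite mX mulrDl -!mulrA; congr (_ + _ * _).
    by rewrite mulrA -commr_polyX mulrA.
  + by rewrite mB // mulrDr -mulrA.
- by move=> u; rewrite coefD coef_map_id0 ?raddf0 // mulrA coefMX addr0.
by rewrite mul1r coefD coef_map_id0 ?raddf0 // coef1 raddf0 add0r coefMX coefC.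
Qed.

(** ** Prescribing the coefficients gamma^1_(lh) *)

Section Adjust.
Variables (N l : nat) (y : {poly A} -> {poly A}) (gam : nat -> nat -> A -> A).
Variable f : A -> A.
Hypotheses (l_gt0 : (0 < l)%N) (lt_lN : (l < N)%N).
Hypotheses (yP : deformation y) (gamP : structure_constants y N gam).
Hypotheses (f_lin : kernel_linear D f) (f1 : f 1 = 0).

Let H a := f a - gam 1 (l * h) a.
(** The correction is the exact error in gamma^1_(lh), put in degree l. *)
Definition adjusted u := y u + map_poly H u * 'X^l.

Let lt_lh : (l * h < N * h)%N. Proof. by rewrite ltn_pmul2r. Qed.
Let yL : series_linear D y. Proof. by case: yP. Qed.

Let H_lin : kernel_linear D H.
Proof.
have [fD fB] := f_lin; split=> [a b|b a Db0].
  by rewrite /H fD (structureD yP gamP) // opprD addrACA.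
by rewrite /H fB // (structure_kernel yP gamP) // mulrBr.
Qed.

Let H1 : H 1 = 0.
Proof.
rewrite /H f1 (structure_kernel1 yP gamP) // ifN ?subr0 //.
by rewrite neq_ltn (leq_trans h_gt1) ?leq_pmull.
Qed.

Lemma adjusted_eqmodX u : eqmodX l (adjusted u) (y u).
Proof. by exists (map_poly H u). Qed.

Lemma adjusted1 : adjusted 1 = y 1.
Proof.
have H10 : map_poly H 1 = 0.
  apply/polyP=> i; rewrite coef_map_id0 ?(kernel_linear0 H_lin) // coef1 coef0.
  by case: i => [|i]; rewrite ?H1 // (kernel_linear0 H_lin).
by rewrite /adjusted H10 mul0r addr0.
Qed.

Lemma adjusted_deformation : deformation adjusted.
Proof.
have [mD mX mB] := series_linear_map H_lin; have [yD yX yB] := yL; split.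
- split=> [u v|u|b u Db0]; rewrite /adjusted.
  + by rewrite yD mD mulrDl addrACA.
  + by rewrite yX mX mulrDl -!mulrA -exprS exprSr.
  + by rewrite yB // mB // mulrDr mulrA.
- move=> u; have [_ y0 _] := yP; rewrite -y0.
  by have /eqmodXP-> := adjusted_eqmodX u.
by rewrite adjusted1; case: yP.
Qed.

Lemma adjusted_iter j u : eqmodX l (iter j adjusted u) (iter j y u).
Proof.
elim: j => [|j IH]; first by apply/eqmodXP.
apply: eqmodX_trans (adjusted_eqmodX _) _; exact: series_linear_eqmodX yL IH.
Qed.

(** Although y changes in degree l, the values y^j(1) do not: the constant term
    of y^j(1) is D^j(1), which is 1 or 0, and the correction kills both. *)
Lemma adjusted_iter1 j : eqmodX l.+1 (iter j adjusted 1) (iter j y 1).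
Proof.
have [aL _ _] := adjusted_deformation.
elim: j => [|j IH]; first by apply/eqmodXP.
apply: eqmodX_trans (series_linear_eqmodX aL IH) _.
rewrite [iter j.+1 _ _]iterS.
apply/eqmodXP=> i lti; rewrite coefD coefMXn; case: ltnP => [_|le_li].
  by rewrite addr0.
have {le_li} -> : i = l by apply/eqP; rewrite eqn_leq le_li andbT -ltnS.
rewrite subnn coef_map_id0 ?(kernel_linear0 H_lin) // (deformation_coef0 yP).
have -> : (1 : {poly A})`_0 = 1 by rewrite coef1.
case: j {IH} => [|j]; first by rewrite H1 addr0.
by rewrite [iter j.+1 D 1]iterSr D1 iter_D0 (kernel_linear0 H_lin) addr0.
Qed.

(** Modulo z^l nothing has changed, so neither have the coefficients below lh.
    In degree l, evaluation of y a at 1 changes by the correction on one side;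
    on the other side the values y^j(1) are the same, the coefficients below
    lh are the same and those above lh do not contribute.  The change is that
    of gamma^1_(lh). *)
Lemma adjusted_structure gam' : structure_constants adjusted N gam' ->
  (forall j, (j < l * h)%N -> gam' 1%N j =1 gam 1%N j) /\
  gam' 1%N (l * h)%N =1 f.
Proof.
move=> gam'P; have aP := adjusted_deformation.
have lo j : (j < l * h)%N -> gam' 1%N j =1 gam 1%N j.
  move=> ltj a; apply: (@deformation_inj y yP l (N * h)
    (fun j => gam' 1%N j a) (fun j => gam 1%N j a)) => //.
    by rewrite leq_mul2r (ltnW lt_lN) orbT.
  move=> u; apply: eqmodX_trans (eqmodX_le (ltnW lt_lN) (gamP 1 a u)).
  apply: eqmodX_trans (adjusted_eqmodX _).
  apply: eqmodX_trans (eqmodX_sym (eqmodX_le (ltnW lt_lN) (gam'P 1%N a u))).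
  apply: eqmodX_sum => i.
  exact/eqmodX_mulC/eqmodX_sym/adjusted_iter.
split=> // a.
have := structure_coef_row gam'P 1 a lt_lN.
have := structure_coef_row gamP 1 a lt_lN.
rewrite /= {2}/adjusted coefD coefMXn ltnn subnn.
rewrite coef_map_id0 ?(kernel_linear0 H_lin) //.
rewrite coefC /= => -> E.
have {E} : H a = \sum_(j < N * h) (gam' 1%N j a - gam 1%N j a) *
                                 chain_matrix y j (l * h).
  under eq_bigr => j _ do rewrite mulrBl.
  rewrite sumrB [RHS]addrC -[LHS](addKr (\sum_(j < N * h) gam 1%N j a *
                                        chain_matrix y j (l * h))) E.
  congr (_ + _); apply: eq_bigr => j _; congr (_ * _).
  rewrite /chain_matrix mulnK // modnMl chain0.
  by have /eqmodXP-> := adjusted_iter1 j.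
rewrite (bigD1 (Ordinal lt_lh)) //= big1 ?addr0 => [|j]; last first.
  rewrite -val_eqE /= neq_ltn => /orP[ltj|ltj].
    by rewrite lo // subrr mul0r.
  by rewrite chain_matrix_low // mulr0.
by rewrite (chain_matrix_diag yP) mulr1 /H => /addIr.
Qed.

End Adjust.

(** Induction on l.  The map gamma^1_0 is D for every deformation, and
    correcting degree l keeps the coefficients obtained before. *)
Lemma deformation_exists N (f : nat -> A -> A) :
    (forall l, (l < N)%N -> kernel_linear D (f l)) ->
    (forall l, (l < N)%N -> f l 1 = 0) -> f 0%N =1 D ->
  exists y gam, [/\ deformation y, structure_constants y N gam
    & forall l, (l < N)%N -> gam 1%N (l * h)%N =1 f l].
Proof.
move=> f_lin f1 f0.
suff H L : (L <= N)%N -> exists y gam, [/\ deformation y,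
    structure_constants y N gam
    & forall l, (l < L)%N -> gam 1%N (l * h)%N =1 f l] by apply: H.
elim: L => [|[|l] IH] leLN.
- have [y yP] := deformation_base.
  by have [gam gamP] := structure_constants_exist yP N; exists y, gam.
- have [y yP] := deformation_base.
  have [gam gamP] := structure_constants_exist yP N; exists y, gam.
  split=> // -[|//] _ a; rewrite f0.
  have := structure_coef_row gamP 1 a leLN; have [_ -> _] := yP.
  rewrite coefC /= => ->; case: (posnP (N * h)) => [|n_gt0].
    by move/eqP; rewrite muln_eq0 (gtn_eqF h_gt0) (gtn_eqF leLN).
  rewrite (bigD1 (Ordinal n_gt0)) //= big1 ?addr0 => [|j].
    by rewrite (chain_matrix_diag yP) mulr1.
  by rewrite -val_eqE /= -lt0n => ltj; rewrite chain_matrix_low ?mulr0.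
have [y [gam [yP gamP gamE]]] := IH (ltnW leLN).
have f_lin_l := f_lin _ leLN; have f1_l := f1 _ leLN.
have aP := adjusted_deformation (ltn0Sn l) leLN yP gamP f_lin_l f1_l.
have [gam' gam'P] := structure_constants_exist aP N.
have [lo top] :=
  adjusted_structure (ltn0Sn l) leLN yP gamP f_lin_l f1_l gam'P.
exists (adjusted l.+1 y gam (f l.+1)), gam'; split=> // i.
rewrite ltnS leq_eqVlt => /predU1P[->|lti]; first exact: top.
by move=> a; rewrite lo ?ltn_pmul2r // gamE.
Qed.

End Deformation.
End JordanChain.

(** * Twisting maps in terms of their coefficients *)

Section TensorSums.
Variables (k : comNzRingType) (M N P : lmodType k).

Lemma pure_suml (I : Type) (r : seq I) (Q : pred I) (F : I -> M) (x : N) :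
  (\sum_(i <- r | Q i) F i) \ot x = \sum_(i <- r | Q i) F i \ot x.
Proof. exact: linear_sumlz. Qed.

Lemma pure_sumr (I : Type) (r : seq I) (Q : pred I) (F : I -> N) (x : M) :
  x \ot (\sum_(i <- r | Q i) F i) = \sum_(i <- r | Q i) x \ot F i.
Proof. exact: linear_sumr. Qed.

Variables (M' N' : lmodType k) (f : {linear M -> M'}) (f' : {linear N -> N'}).

Lemma tmap_sum (I : Type) (r : seq I) (Q : pred I) (F : I -> M \ox N) :
  tmap f f' (\sum_(i <- r | Q i) F i) = \sum_(i <- r | Q i) tmap f f' (F i).
Proof. exact: linear_sum. Qed.

Lemma tassoc_sum (I : Type) (r : seq I) (Q : pred I)
    (F : I -> (M \ox N) \ox P) :
  tassoc (\sum_(i <- r | Q i) F i) = \sum_(i <- r | Q i) tassoc (F i).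
Proof. exact: linear_sum. Qed.

Lemma tunassoc_sum (I : Type) (r : seq I) (Q : pred I)
    (F : I -> M \ox (N \ox P)) :
  tunassoc (\sum_(i <- r | Q i) F i) = \sum_(i <- r | Q i) tunassoc (F i).
Proof. exact: linear_sum. Qed.

End TensorSums.

Section Twisting.
Variables (k : comNzRingType) (A : algType k) (n : nat).
Hypothesis n_gt0 : (0 < n)%N.
Local Notation C := ({poly %/ ('X^n : {poly k})} : algType k).
Local Notation Y := ('qX : C).

Lemma qX_exp_ge r : (n <= r)%N -> Y ^+ r = 0.
Proof.
move=> ler; rewrite -(subnK ler) exprD (_ : Y ^+ n = 0) ?mulr0 //.
rewrite /qpolyX -rmorphXn; apply/val_inj => /=.
by rewrite mk_monic_Xn prednK // Pdiv.RingMonic.rmodpp ?monicXn.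
Qed.

(** The expansion of a pure tensor in the shape taken by the unit axioms and by
    the values on ker D. *)
Lemma sum_tensor_powers1 r (a : A) : (r < n)%N ->
  \sum_(j < n) (if j == r :> nat then a else 0) \ot Y ^+ j = a \ot Y ^+ r.
Proof.
move=> ltr; rewrite (bigD1 (Ordinal ltr)) //= eqxx big1 ?addr0 // => j.
by rewrite -val_eqE /= => /negPf->; rewrite linear0l.
Qed.

Lemma twist_expand (s : {linear C \ox A -> A \ox C}) r a :
  s (Y ^+ r \ot a) = \sum_(j < n) gamma s r j a \ot Y ^+ j.
Proof. exact: tcoef_sum. Qed.

Lemma eq_tensor_powers (c c' : nat -> A) :
  \sum_(j < n) c j \ot Y ^+ j = \sum_(j < n) c' j \ot Y ^+ j <->
  forall j, (j < n)%N -> c j = c' j.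
Proof.
split=> [E j ltj | E]; last by apply: eq_bigr => j _; rewrite E.
by rewrite -(tcoef_uniq n_gt0 c) // E tcoef_uniq.
Qed.

(** A linear map on one of the tensor products in the axioms is determined by
    its values where each element of C is a power of y. *)
Lemma linear_ext_powers (P : lmodType k) (f f' : {linear C \ox A -> P}) :
  (forall r a, (r < n)%N -> f (Y ^+ r \ot a) = f' (Y ^+ r \ot a)) -> f =1 f'.
Proof.
move=> ff'; apply: tensor_linear_ext => c a; rewrite (truncE n_gt0 c).
rewrite pure_suml !linear_sum; apply: eq_bigr => j _.
by rewrite linearZl_LR !linearZ ff'.
Qed.

Lemma linear_ext_powers2 (P : lmodType k)
    (f f' : {linear (C \ox C) \ox A -> P}) :
  (forall r q a, (r < n)%N -> (q < n)%N ->
     f ((Y ^+ r \ot Y ^+ q) \ot a) = f' ((Y ^+ r \ot Y ^+ q) \ot a)) -> f =1 f'.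
Proof.
move=> ff'; apply: tensor_linear_ext => u a; rewrite (tensor_pureE u).
rewrite pure_suml !linear_sum; apply: eq_bigr => -[c d] _ /=.
rewrite (truncE n_gt0 c) (truncE n_gt0 d) pure_suml pure_suml !linear_sum.
apply: eq_bigr => r _; rewrite pure_sumr pure_suml !linear_sum.
apply: eq_bigr => q _.
by rewrite linearZl_LR linearZr_LR !linearZl_LR !linearZ ff'.
Qed.

Lemma linear_ext_products (P : lmodType k)
    (f f' : {linear C \ox (A \ox A) -> P}) :
  (forall r a b, (r < n)%N ->
     f (Y ^+ r \ot (a \ot b)) = f' (Y ^+ r \ot (a \ot b))) -> f =1 f'.
Proof.
move=> ff'; apply: tensor_linear_ext => c u; rewrite (tensor_pureE u).
rewrite pure_sumr !linear_sum; apply: eq_bigr => -[a b] _ /=.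
rewrite (truncE n_gt0 c) pure_suml !linear_sum.
by apply: eq_bigr => r _; rewrite linearZl_LR !linearZ ff'.
Qed.

Lemma tmul_powers r q (a : A) :
  tmap tmul idfun ((Y ^+ r \ot Y ^+ q) \ot a) = Y ^+ (r + q) \ot a.
Proof. by rewrite tmapE exprD; congr (_ \ot _); apply: tmulE. Qed.

Lemma tmul_products r (a b : A) :
  tmap idfun tmul (Y ^+ r \ot (a \ot b)) = Y ^+ r \ot (a * b).
Proof. by rewrite tmapE; congr (_ \ot _); apply: tmulE. Qed.

Section Hexagons.
Variable s : {linear C \ox A -> A \ox C}.
Local Notation gam := (gamma s).

(** The right-hand sides of the two hexagon axioms, named so as to carry a
    linear structure. *)
Definition hexagonC : (C \ox C) \ox A -> A \ox C :=
  tmap idfun tmul \o tassoc \o tmap s idfun \o tunassoc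
    \o tmap idfun s \o tassoc.
HB.instance Definition _ := GRing.Linear.on hexagonC.

Definition hexagonA : C \ox (A \ox A) -> A \ox C :=
  tmap tmul idfun \o tunassoc \o tmap idfun s \o tassoc
    \o tmap s idfun \o tunassoc.
HB.instance Definition _ := GRing.Linear.on hexagonA.

Lemma hexagonC_powers r q a : hexagonC ((Y ^+ r \ot Y ^+ q) \ot a) =
  \sum_(j < n) (\sum_(i < j.+1) gam r (j - i)%N (gam q i a)) \ot Y ^+ j.
Proof.
rewrite /hexagonC /= tassocE tmapE /= twist_expand pure_sumr.
rewrite tunassoc_sum (tmap_sum s) tassoc_sum.
rewrite tmap_sum.
transitivity (\sum_(i < n) \sum_(l < n)
                gam r l (gam q i a) \ot Y ^+ (l + i)).
  apply: eq_bigr => i _; rewrite tunassocE tmapE twist_expand pure_suml.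
  rewrite tassoc_sum tmap_sum.
  apply: eq_bigr => l _; rewrite tassocE tmapE exprD.
  by congr (_ \ot _); apply: tmulE.
pose G l i := gam r l (gam q i a) \ot Y ^+ (l + i).
transitivity (\sum_(i < n) \sum_(l < n | (l + i < n)%N) G l i).
  apply: eq_bigr => i _; rewrite [RHS]big_mkcond; apply: eq_bigr => l _ /=.
  by case: ltnP => // le; rewrite /G qX_exp_ge // linear0r.
rewrite sum_convolution; apply: eq_bigr => j _; rewrite pure_suml.
by apply: eq_bigr => i _; rewrite /G subnK // -ltnS.
Qed.

Lemma hexagonA_products r a b : hexagonA (Y ^+ r \ot (a \ot b)) =
  \sum_(j < n) (\sum_(i < n) gam r i a * gam i j b) \ot Y ^+ j.
Proof.
rewrite /hexagonA /= tunassocE tmapE twist_expand pure_suml.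
rewrite tassoc_sum (tmap_sum idfun s) tunassoc_sum.
rewrite tmap_sum.
transitivity (\sum_(i < n) \sum_(j < n) (gam r i a * gam i j b) \ot Y ^+ j).
  apply: eq_bigr => i _; rewrite tassocE tmapE twist_expand pure_sumr.
  rewrite tunassoc_sum tmap_sum.
  apply: eq_bigr => j _; rewrite tunassocE tmapE.
  by congr (_ \ot _); apply: tmulE.
by rewrite exchange_big; apply: eq_bigr => j _; rewrite pure_suml.
Qed.

(** Both sides of each axiom are linear, so it suffices to compare them on the
    powers of y, and the coefficients there can be compared one by one. *)
Lemma twistingP : twisting_map s <-> twisting_family n gam.
Proof.
split=> [[[s1 s1'] sC sA] | [g0 g1 gC gA gn]].
  split.
  - move=> j a ltj; rewrite /gamma expr0 s1 tcoefE.
    rewrite -(expr0 Y) qX_exp // coefXn.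
    by case: eqP; rewrite (scale1r, scale0r).
  - move=> r j ltr ltj; rewrite /gamma s1' tcoefE qX_exp // coefXn eq_sym.
    by case: eqP; rewrite (scale1r, scale0r).
  - move=> r q j a ltj.
    have := sC ((Y ^+ r \ot Y ^+ q) \ot a).
    rewrite tmul_powers -[RHS]/(hexagonC _) hexagonC_powers twist_expand.
    move/(eq_tensor_powers (fun j => gam (r + q)%N j a)
      (fun j => \sum_(i < j.+1) gam r (j - i)%N (gam q i a))); exact.
  - move=> r j a b ltj.
    have := sA (Y ^+ r \ot (a \ot b)).
    rewrite tmul_products -[RHS]/(hexagonA _) hexagonA_products twist_expand.
    move/(eq_tensor_powers (fun j => gam r j (a * b))
      (fun j => \sum_(i < n) gam r i a * gam i j b)); exact.
  - by move=> r j a ler ltj; rewrite /gamma qX_exp_ge // linear0l !linear0.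
split; first split.
- move=> a; rewrite -[1]/(Y ^+ 0) twist_expand -(@sum_tensor_powers1 0) //.
  by apply: eq_bigr => j _; rewrite g0.
- move=> c; rewrite (truncE n_gt0 c) pure_suml pure_sumr linear_sum.
  apply: eq_bigr => r _; rewrite linearZl_LR linearZr_LR linearZ.
  congr (_ *: _); rewrite twist_expand -[RHS](sum_tensor_powers1 1 (ltn_ord r)).
  apply: eq_bigr => j _; by rewrite g1 // eq_sym; case: eqP.
- apply: (linear_ext_powers2 (f := s \o tmap tmul idfun) (f' := hexagonC)).
  move=> r q a ltr ltq; apply: etrans (esym (hexagonC_powers r q a)).
  rewrite /= tmul_powers twist_expand.
  by apply: eq_bigr => j _; rewrite gC.
- apply: (linear_ext_products (f := s \o tmap idfun tmul) (f' := hexagonA)).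
  move=> r a b ltr; apply: etrans (esym (hexagonA_products r a b)).
  rewrite /= tmul_products twist_expand.
  by apply: eq_bigr => j _; rewrite gA.
Qed.

End Hexagons.
End Twisting.

(** * Twisting maps with given coefficients *)

Section Realization.
Variables (k : comNzRingType) (A : algType k) (n : nat).
Hypothesis n_gt0 : (0 < n)%N.
Local Notation C := ({poly %/ ('X^n : {poly k})} : algType k).
Variable gam : nat -> nat -> A -> A.
Hypothesis gam_linear : forall r j, (j < n)%N -> linear (gam r j).

Definition family_twist (c : C) (a : A) : A \ox C :=
  \sum_(r < n) (c : {poly k})`_r *: \sum_(j < n) gam r j a \ot 'qX ^+ j.

Lemma family_twist_bilinear : bilinear_for *:%R *:%R family_twist.
Proof.
split=> [a t c c' | c t a a']; rewrite /family_twist /=.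
  rewrite scaler_sumr -big_split; apply: eq_bigr => r _ /=.
  by rewrite coefD coefZ scalerDl scalerA.
rewrite scaler_sumr -big_split; apply: eq_bigr => r _ /=.
rewrite scalerA mulrC -scalerA -scalerDr; congr (_ *: _).
rewrite scaler_sumr -big_split; apply: eq_bigr => j _ /=.
by rewrite gam_linear // linearPl.
Qed.

HB.instance Definition _ :=
  bilinear_isBilinear.Build k C A (A \ox C)%type *:%R *:%R family_twist
    family_twist_bilinear.

Lemma twist_of_family : exists s : {linear C \ox A -> A \ox C},
  forall r j a, (r < n)%N -> (j < n)%N -> gamma s r j a = gam r j a.
Proof.
pose s : {linear C \ox A -> A \ox C} := tlift family_twist.
exists s; apply/(gammaP n_gt0) => r a ltr.
rewrite /s /= tlift_pure /= /family_twist (bigD1 (Ordinal ltr)) //= qX_exp //.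
rewrite coefXn eqxx scale1r [X in _ + X]big1 ?addr0 //.
by move=> i; rewrite -val_eqE /= coefXn => /negPf->; rewrite scale0r.
Qed.

End Realization.

(** * Uniqueness of the coefficient maps *)

Section Rigidity.
Variables (A : nzRingType) (D : {additive A -> A}) (h N n : nat)
  (e : nat -> A).
Hypothesis D_nilp : forall a, iter h D a = 0.
Hypothesis D1 : D 1 = 0.
Hypothesis eP : forall j, (j < h)%N -> iter j D (e j) = 1.
Hypothesis h_gt0 : (0 < h)%N.
Hypothesis nE : n = (N * h)%N.

Section OneFamily.
Variable gam : nat -> nat -> A -> A.
Hypothesis gamP : twisting_family n gam.
Hypothesis gam0 : forall r j, gam r j 0 = 0.
Hypothesis gamD : gam 1%N 0%N =1 D.

Lemma family_col0 r a : (0 < n)%N -> gam r 0%N a = iter r D a.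
Proof.
have [gam_0 _ gam_comp _ _] := gamP.
move=> n_gt0; elim: r => [|r IH] /=; first by rewrite gam_0.
by rewrite -(add1n r) gam_comp // big_ord1 IH gamD.
Qed.

(** In degree 0 the product rule for y^h a e_m reads
    0 = D^h(a e_m) = sum_i gamma^h_i(a) D^i(e_m), a unitriangular system for
    gamma^h_i(a), i < h. *)
Lemma family_pow_h j a : (j < h)%N -> (j < n)%N -> gam h j a = 0.
Proof.
move=> ltjh ltjn; have n_gt0 : (0 < n)%N by apply: leq_ltn_trans ltjn.
have le_hn : (h <= n)%N.
  by move: n_gt0; rewrite nE muln_gt0 => /andP[N_gt0 _]; apply: leq_pmull.
have [_ _ _ gam_mul _] := gamP.
apply: (@unitriangular_zero _ 0 h n (fun i => gam h i a)
         (fun i m => gam i 0%N (e m))) => //.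
- by move=> i m ltm lti; rewrite family_col0 // (iter_De D1 eP).
- by move=> m ltm; rewrite family_col0 // eP.
- by move=> m ltm; rewrite -gam_mul // family_col0 // D_nilp.
Qed.

(** y^(lh) is a product of l factors y^h, each of order at least h. *)
Lemma family_low l r j a : (l * h <= r)%N -> (j < l * h)%N -> (j < n)%N ->
  gam r j a = 0.
Proof.
have [_ _ gam_comp _ _] := gamP.
elim: l r j a => [//|l IH] r j a; rewrite mulSn => ler ltj ltjn.
have le_hr : (h <= r)%N := leq_trans (leq_addr _ _) ler.
rewrite -(subnKC le_hr) gam_comp // big1 // => i _.
have lei : (i <= j)%N by rewrite -ltnS.
have [lti|gei] := ltnP i (l * h).
  rewrite (IH (r - h)%N i) ?gam0 ?leq_subRL //.
  exact: leq_ltn_trans lei ltjn.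
rewrite family_pow_h // ?(leq_ltn_trans (leq_subr _ _) ltjn) //.
by rewrite ltn_subLR // (leq_trans ltj) // addnC leq_add2r.
Qed.

(** The composition rule for y^(lh) y^i in degree lh: by the order of y^(lh)
    only the degree 0 part D^i of y^i can contribute. *)
Lemma family_diag l i a : (l < N)%N ->
  gam (l * h + i)%N (l * h)%N a = gam (l * h)%N (l * h)%N (iter i D a).
Proof.
move=> ltl; have ltn : (l * h < n)%N by rewrite nE ltn_pmul2r.
have n_gt0 : (0 < n)%N by apply: leq_ltn_trans ltn.
have [_ _ gam_comp _ _] := gamP.
rewrite gam_comp // big_ord_recl subn0 family_col0 // big1 ?addr0 // => t _.
have lt' : (l * h - bump 0 t < l * h)%N.
  by rewrite ltn_subrL (leq_ltn_trans _ (ltn_ord t)).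
by rewrite (family_low (l := l)) // (ltn_trans lt').
Qed.

End OneFamily.

Section TwoFamilies.
Variables gam gam' : nat -> nat -> A -> A.
Hypotheses (gamP : twisting_family n gam) (gam'P : twisting_family n gam').
Hypothesis gam0 : forall r j, gam r j 0 = 0.
Hypothesis gamD : gam 1%N 0%N =1 D.
Hypothesis gamE :
  forall l, (l < N)%N -> gam 1%N (l * h)%N =1 gam' 1%N (l * h)%N.

(** By the composition rule gamma^r_m involves only the gamma^1_j with
    j <= m. *)
Lemma family_eq_row1 m : (m < n)%N ->
    (forall j, (j <= m)%N -> gam 1%N j =1 gam' 1%N j) ->
  forall r, gam r m =1 gam' r m.
Proof.
move=> ltm E1 r; have [g0 _ gC _ _] := gamP; have [g'0 _ g'C _ _] := gam'P.
suff H j : (j <= m)%N -> gam r j =1 gam' r j by apply: H.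
elim: r j => [|r IH] j lejm a; have ltj := leq_ltn_trans lejm ltm.
  by rewrite g0 // g'0.
rewrite -add1n gC // g'C //; apply: eq_bigr => i _.
have lei : (i <= j)%N by rewrite -ltnS.
by rewrite IH ?(leq_trans lei) // E1 // (leq_trans (leq_subr _ _)).
Qed.

(** Induction on blocks of length h.  Once the two families agree below L h and
    at L h, so do all gamma^r_(Lh); subtracting the product rules in degree L h
    for a e_m leaves a unitriangular system for the differences at
    L h, ..., L h + h - 1. *)
Lemma family_unique r j : (j < n)%N -> gam r j =1 gam' r j.
Proof.
move=> ltj; apply: family_eq_row1 => // {r} i lei.
have {j ltj lei} : (i < n)%N by apply: leq_ltn_trans ltj.
suff H L : (L <= N)%N -> forall i, (i < L * h)%N -> gam 1%N i =1 gam' 1%N i.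
  by rewrite nE; apply: H.
elim: L {i} => [//|L IH] ltLN i lti a; apply/eqP; rewrite -subr_eq0; apply/eqP.
have ltLh : (L * h < n)%N by rewrite nE ltn_pmul2r.
have col r : gam r (L * h)%N =1 gam' r (L * h)%N.
  apply: family_eq_row1 => // j; rewrite leq_eqVlt => /predU1P[->|ltj].
    exact: gamE.
  exact: IH (ltnW ltLN) _ ltj.
have [_ g1 _ gM _] := gamP; have [_ _ _ g'M _] := gam'P.
apply: (@unitriangular_zero _ (L * h) h n (fun i => gam 1%N i a - gam' 1%N i a)
         (fun i m => gam i (L * h)%N (e m))).
- by rewrite nE addnC -mulSn leq_mul2r ltLN orbT.
- by move=> j ltj; rewrite (IH (ltnW ltLN) _ ltj) subrr.
- move=> j m ltm ltj; rewrite -(subnKC (leq_trans (leq_addr _ _) (ltnW ltj))).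
  rewrite family_diag // (iter_De D1 eP) // ltn_subRL //.
- by move=> m ltm; rewrite family_diag // eP // g1 // eqxx.
- move=> m ltm; under eq_bigr => j _ do rewrite mulrBl.
  rewrite sumrB -gM //; under eq_bigr => j _ do rewrite col.
  by rewrite -g'M // col subrr.
- by rewrite addnC -mulSn.
Qed.

End TwoFamilies.
End Rigidity.

Theorem theorem3p2 (k : comNzRingType) (A : algType k) (n h : nat)
    (n_gt0 : (0 < n)%N) (h_gt1 : (1 < h)%N) (h_dvd_n : (h %| n)%N)
    (g : nat -> {linear A -> A})
    (g_1 : forall l, (l < n %/ h)%N -> g l 1 = 0)
    (g0_nilp : forall a, iter h (g 0%N) a = 0)
    (g0_inv : exists x q' : A, q' * iter h.-1 (g 0%N) x = 1 /\
                           iter h.-1 (g 0%N) x * q' = 1)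
    (B_subalg : GRing.subalg_closed (kernel (g 0%N)))
    (B_central : forall b a, b \in kernel (g 0%N) -> GRing.comm b a)
    (g_Blinear : forall l, (l < n %/ h)%N ->
       forall b a, b \in kernel (g 0%N) -> g l (b * a) = b * g l a) :
  let C := {poly %/ ('X^n : {poly k})} : algType k in
  exists s : {linear C \ox A -> A \ox C},
    [/\ twisting_map s,
        forall l, (l < n %/ h)%N -> gamma s 1 (l * h) =1 g l,
        forall s' : {linear C \ox A -> A \ox C}, twisting_map s' ->
          (forall l, (l < n %/ h)%N -> gamma s' 1 (l * h) =1 g l) -> s' =1 s
      & forall (c : C) b, b \in kernel (g 0%N) -> s (c \ot b) = b \ot c].
Proof.
move=> C; pose N := (n %/ h)%N; pose D : {additive A -> A} := g 0%N.
have En : (N * h)%N = n by rewrite divnK.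
have h_gt0 : (0 < h)%N := ltnW h_gt1.
have N_gt0 : (0 < N)%N by rewrite divn_gt0 // dvdn_leq.
have kerP b : (b \in kernel (g 0%N)) = (D b == 0) by [].
have kerC b a : D b = 0 -> b * a = a * b.
  by move=> Db0; apply: B_central; rewrite kerP Db0.
have f_lin l : (l < N)%N -> kernel_linear D (g l).
  move=> ltl; split=> [a b|b a Db0]; first exact: raddfD.
  by rewrite g_Blinear // kerP Db0.
have D_lin : kernel_linear D D := f_lin 0%N N_gt0.
have D1 : D 1 = 0 := g_1 0%N N_gt0.
have [x [q' [q'q qq']]] := g0_inv.
(* q = D^(h-1)(x) lies in ker D, hence so does its inverse *)
have Dq' : D q' = 0.
  rewrite -[D q']mul1r -q'q -mulrA -(proj2 D_lin) ?qq' ?D1 ?mulr0 //.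
  by rewrite -iterS prednK.
pose e j := q' * iter (h.-1 - j) D x.
have eP j : (j < h)%N -> iter j D (e j) = 1.
  move=> ltj; rewrite (iter_D_linear D_lin) // -iterD subnKC //.
  by rewrite -ltnS prednK.
have [y [gam [yP gamP gamE]]] :=
  deformation_exists D_lin g0_nilp D1 eP h_gt1 kerC f_lin g_1 (frefl _).
(* scalars lie in ker D, so additivity and ker D-linearity give k-linearity *)
have Dk c : D c%:A = 0.
  have -> : D c%:A = c *: g 0%N 1 by apply: linearZ.
  by rewrite -/D D1 scaler0.
have structD := structureD g0_nilp D1 eP h_gt1 yP gamP.
have struct_ker := structure_kernel g0_nilp D1 eP h_gt1 yP gamP.
have struct_ker1 := structure_kernel1 g0_nilp D1 eP h_gt1 yP gamP.
have gam_fam := structure_twisting_family g0_nilp D1 eP h_gt1 yP gamP.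
rewrite En in structD struct_ker struct_ker1 gam_fam.
have gam_linear r j : (j < n)%N -> linear (gam r j).
  move=> ltj c a b; rewrite structD // -[c *: a]mulr_algl struct_ker //.
  by rewrite mulr_algl.
have [s sE] := twist_of_family n_gt0 gam_linear.
have {}sE r j : (j < n)%N -> gam r j =1 gamma s r j.
  move=> ltj a; have [ltr|ler] := ltnP r n; first by rewrite sE.
  have [_ _ _ _ ->] // := gam_fam.
  by rewrite /gamma qX_exp_ge // linear0l !linear0.
have s_fam : twisting_family n (gamma s) := eq_twisting_family sE gam_fam.
have lt_lh l : (l < N)%N -> (l * h < n)%N by move=> ltl; rewrite -En ltn_pmul2r.
have s_twist : twisting_map s by apply/twistingP.
have sg l : (l < N)%N -> gamma s 1 (l * h) =1 g l.
  by move=> ltl a; rewrite -sE ?gamE // lt_lh.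
exists s; split=> //.
- move=> s' /(twistingP n_gt0) s'_fam s'g.
  have s'0 r j : gamma s' r j 0 = 0 by rewrite /gamma linear0r !linear0.
  apply: (linear_ext_powers n_gt0) => r a ltr; rewrite !twist_expand //.
  apply: eq_bigr => j _; congr (_ \ot _).
  apply: (family_unique g0_nilp D1 eP h_gt0 (esym En) s'_fam s_fam)
    => // [b|l ltl b].
  + exact: s'g 0%N N_gt0 b.
  + by rewrite s'g // sg.
move=> c b; rewrite kerP => /eqP Db0.
rewrite (truncE n_gt0 c) pure_suml pure_sumr linear_sum; apply: eq_bigr => r _.
rewrite linearZl_LR linearZr_LR linearZ; congr (_ *: _).
rewrite twist_expand // -[RHS](sum_tensor_powers1 b (ltn_ord r)).
by apply: eq_bigr => j _; rewrite -sE // struct_ker1 // eq_sym.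
Qed.
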